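(* Let $\Theta_1,\Theta_2$ be standard s-substitutions such that all parameters occurring in the domains and ranges of $\Theta_1,\Theta_2$ are among $\{n_1,\ldots,n_\gamma\}$, and let $\mathcal D$ be the set of states over $\{n_1,\ldots,n_\gamma\}$. Then for every $p\in\mathcal D$ and every parameter assignment $\sigma\in\mathcal S(p)$ we have $\sigma((\Theta_1\circ\Theta_2)|_p){\downarrow}=\Theta_1[\sigma]\Theta_2[\sigma]$, where $(\Theta_1\circ\Theta_2)|_p=\psi_p(\Theta_1)\psi_p(\Theta_2)$.
   Context: Parameters range over natural numbers; numerals are $\bar0,\bar1=s(\bar0),\bar2,\ldots$; a parameter assignment $\sigma$ maps parameters to numerals and evaluates terms built from $\bar0$, parameters, $s$ and $p$ (predecessor, $p(\bar0)=\bar0$). For $k\ge1$, a $k$-ary variable class $X$ is a set of first-order variables $X(\nu_1,\ldots,\nu_k)$ indexed bijectively by $k$-tuples of numerals (distinct classes disjoint); $X(r_1,\ldots,r_k)$ with numeric terms $r_i$ is a variable expression, $\sigma(X(r_1,\ldots,r_k)){\downarrow}=X(\sigma(r_1){\downarrow},\ldots,\sigma(r_k){\downarrow})$. Schematic individual terms are built from constants, variables, variable expressions, first-order function symbols and primitive-recursively defined schematic term symbols $\hat t(s_1,\ldots,s_i,r_1,\ldots,r_j)$; $\sigma(t){\downarrow}$ is the first-order term obtained by evaluating under $\sigma$ and unfolding definitions. Each variable class $X$ of arity $k$ has a fixed parameter list $(m_1,\ldots,m_k)$; $X(r_1,\ldots,r_k)$ is standard if each $r_i\in\{m_i,\bar0,p(m_i),s(m_i)\}$;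 a standard term has only standard variable expressions. Two variable expressions are parameter-unifiable if some $\sigma$ evaluates them to the same variable. A standard s-substitution is $\Theta=\{A_1\leftarrow t_1,\ldots,A_\alpha\leftarrow t_\alpha\}$ with $A_i$ standard variable expressions, $t_i$ standard terms, $A_i,A_j$ not parameter-unifiable for $i\neq j$; $\Theta[\sigma]=\{\sigma(A_i){\downarrow}\leftarrow\sigma(t_i){\downarrow}\}_i$, a first-order substitution; for any finite set $\Delta=\{B_j\leftarrow u_j\}$ of bindings of variable expressions, $\sigma(\Delta){\downarrow}=\{\sigma(B_j){\downarrow}\leftarrow\sigma(u_j){\downarrow}\}_j$. $\Theta_1[\sigma]\Theta_2[\sigma]$ is ordinary composition of first-order substitutions. A state over a finite parameter set $\mathcal P$ is a conjunction choosing for each $m\in\mathcal P$ one of: $m=\bar0$; $m\neq\bar0\wedge p(m)=\bar0$; $m\neq\bar0\wedge p(m)\neq\bar0$; $\mathcal S(p)$ is the set of assignments satisfying $p$. $\psi_p$ on a standard variable expression $X(r_1,\ldots,r_k)$ with list $(m_1,\ldots,m_k)$: for each $i$, if $p$ contains $m_i=\bar0$, replace $r_i\in\{m_i,p(m_i),\bar0\}$ by $\bar0$ and $s(m_i)$ by $\bar1$; if $p$ contains $m_i\neq\bar0\wedge p(m_i)=\bar0$, replace $p(m_i)$ by $\bar0$, $m_i$ by $\bar1$, $s(m_i)$ by $\bar2$, leave $\bar0$; otherwise leave $r_i$. $\psi_p$ fixes constants and ordinary variables, is homomorphic over function symbols and individual arguments of schematic symbols, and $\psi_p(\Theta)=\{\psi_p(A_i)\leftarrow\psi_p(t_i)\}_i$.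 Syntactic application $u\Delta$ replaces every occurrence in $u$ of a variable expression syntactically identical to some $B_j$ by $u_j$; syntactic composition of binding sets is $\{A_i\leftarrow a_i\}_i\{B_j\leftarrow b_j\}_j=\{A_i\leftarrow a_i\{B_j\leftarrow b_j\}_j\}_i\cup\{B_j\leftarrow b_j : B_j \text{ syntactically distinct from all } A_i\}$. *)

(* Defs.v *)
From HB Require Import structures.
From mathcomp Require Import all_boot.
From mathcomp Require Import boolp.

Set Implicit Arguments.
Unset Strict Implicit.
Unset Printing Implicit Defensive.

(* Numerals are identified with elements of [nat]. *)
Inductive nterm (N : Type) : Type :=
| NZero
| NPar of N
| NSucc of nterm N
| NPred of nterm N.
Arguments NZero {N}.

Section NumericTerms.
Variable N : eqType.

Fixpoint nterm_eqb (r s : nterm N) : bool :=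
  match r, s with
  | NZero, NZero => true
  | NPar m, NPar n => m == n
  | NSucc r', NSucc s' => nterm_eqb r' s'
  | NPred r', NPred s' => nterm_eqb r' s'
  | _, _ => false
  end.

Lemma nterm_eqP : Equality.axiom nterm_eqb.
Proof.
elim=> [|m|r IH|r IH] [|n|s|s] /=; try by constructor.
- by apply: (iffP eqP) => [->|[->]].
- by apply: (iffP (IH s)) => [->|[->]].
- by apply: (iffP (IH s)) => [->|[->]].
Qed.

HB.instance Definition _ := hasDecEq.Build (nterm N) nterm_eqP.

End NumericTerms.

Fixpoint neval (N : Type) (sigma : N -> nat) (r : nterm N) : nat :=
  match r with
  | NZero => 0
  | NPar m => sigma m
  | NSucc r' => (neval sigma r').+1
  | NPred r' => (neval sigma r').-1
  end.

Definition numeral (N : Type) (k : nat) : nterm N := iter k (@NSucc N) NZero.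

Fixpoint nparams (N : Type) (r : nterm N) : seq N :=
  match r with
  | NZero => [::]
  | NPar m => [:: m]
  | NSucc r' | NPred r' => nparams r'
  end.

(* First-order terms; constants are the function symbols of arity 0. *)
Inductive foterm (F : Type) (far : F -> nat) (V : Type) : Type :=
| FVar of V
| FFun (f : F) of {ffun 'I_(far f) -> foterm far V}.

HB.instance Definition _ (F : Type) (far : F -> nat) (V : Type) :=
  gen_eqMixin (foterm far V).

(* Terms over individual leaves [V], numeric leaves [N] and schematic term    *)
(* symbols [T]. [TSym t ss rs r] is t^(ss, rs, r): the last numeric argument, *)
(* on which t^ recurs, is kept apart from the [nar t] numeric arguments [rs]. *)
Inductive schterm (F : Type) (far : F -> nat) (T : Type) (iar nar : T -> nat)
    (V N : Type) : Type :=
| TVar of V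
| TFun (f : F) of {ffun 'I_(far f) -> schterm far iar nar V N}
| TSym (t : T) of {ffun 'I_(iar t) -> schterm far iar nar V N} &
    (nar t).-tuple (nterm N) & nterm N.
Arguments TVar {F far T iar nar V N}.
Arguments TFun {F far T iar nar V N}.
Arguments TSym {F far T iar nar V N}.

HB.instance Definition _ (F : Type) (far : F -> nat) (T : Type)
    (iar nar : T -> nat) (V N : Type) :=
  gen_eqMixin (schterm far iar nar V N).

Section SchematicTerms.
Variables (F : Type) (far : F -> nat) (T : Type) (iar nar : T -> nat).
Variables (V N : Type).

Lemma foterm_ind' (P : foterm far V -> Prop) :
  (forall x, P (FVar far x)) ->
  (forall (f : F) (ts : {ffun 'I_(far f) -> foterm far V}),
     (forall i, P (ts i)) -> P (FFun ts)) ->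
  forall t, P t.
Proof.
by move=> Hvar Hfun; fix IH 1; case=> [x|f ts]; [exact: Hvar | exact: Hfun].
Qed.

Lemma schterm_ind' (P : schterm far iar nar V N -> Prop) :
  (forall v, P (TVar v)) ->
  (forall f (ts : {ffun 'I_(far f) -> schterm far iar nar V N}),
     (forall i, P (ts i)) -> P (TFun f ts)) ->
  (forall t (ts : {ffun 'I_(iar t) -> schterm far iar nar V N}) rs r,
     (forall i, P (ts i)) -> P (TSym t ts rs r)) ->
  forall u, P u.
Proof.
move=> Hvar Hfun Hsym; fix IH 1; case=> [x|f ts|t ts rs r].
- exact: Hvar.
- exact: Hfun.
- exact: Hsym.
Qed.

Fixpoint leaves (u : schterm far iar nar V N) : seq V :=
  match u with
  | TVar v => [:: v]
  | TFun f ts => flatten [seq leaves (ts i) | i <- enum 'I_(far f)]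
  | TSym t ts _ _ => flatten [seq leaves (ts i) | i <- enum 'I_(iar t)]
  end.

Fixpoint numargs (u : schterm far iar nar V N) : seq (nterm N) :=
  match u with
  | TVar _ => [::]
  | TFun f ts => flatten [seq numargs (ts i) | i <- enum 'I_(far f)]
  | TSym t ts rs r =>
      rcons rs r ++ flatten [seq numargs (ts i) | i <- enum 'I_(iar t)]
  end.

Fixpoint tbind (g : V -> schterm far iar nar V N)
    (u : schterm far iar nar V N) : schterm far iar nar V N :=
  match u with
  | TVar v => g v
  | TFun f ts => TFun f [ffun i => tbind g (ts i)]
  | TSym t ts rs r => TSym t [ffun i => tbind g (ts i)] rs r
  end.

(* The value of a term, given the values of the schematic symbols ([U]), of   *)
(* the individual leaves ([rho]) and of the numeric leaves ([sigma]).         *)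
Fixpoint teval (W : Type)
    (U : forall t : T, ('I_(iar t) -> foterm far W) -> ('I_(nar t) -> nat) ->
                       nat -> foterm far W)
    (rho : V -> foterm far W) (sigma : N -> nat)
    (u : schterm far iar nar V N) : foterm far W :=
  match u with
  | TVar v => rho v
  | TFun f ts => FFun [ffun i => teval U rho sigma (ts i)]
  | TSym t ts rs r =>
      U t (fun i => teval U rho sigma (ts i))
          (fun i => neval sigma (tnth rs i)) (neval sigma r)
  end.

Lemma eq_teval (W : Type)
    (U U' : forall t : T, ('I_(iar t) -> foterm far W) ->
       ('I_(nar t) -> nat) -> nat -> foterm far W) rho sigma u :
  (forall t, U t = U' t) -> teval U rho sigma u = teval U' rho sigma u.
Proof.
by move=> eqU; have -> // : U = U' by apply: functional_extensionality_dep.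
Qed.

End SchematicTerms.

(* [vparams X] is the fixed parameter list of the variable class [X]. A       *)
(* schematic term symbol t^ is defined by primitive recursion:                *)
(*   t^(x, n, 0)    = tbase t                                                 *)
(*   t^(x, n, s(m)) = tstep t {xi <- t^(x, n, m)}                             *)
(* In [tstep t] the leaf [None] stands for xi (individual) or m (numeric). The *)
(* right-hand sides use only symbols of smaller rank, and their only leaves   *)
(* are the formal arguments: in particular no variable expressions.           *)
Record signature := Signature {
  param : eqType;
  ovar : eqType;
  fsym : Type;
  farity : fsym -> nat;
  vclass : eqType;
  varity : vclass -> nat;
  varity_gt0 : forall X, 0 < varity X;
  vparams : forall X, (varity X).-tuple param;
  tsym : Type;
  tiarity : tsym -> nat;
  tnarity : tsym -> nat;
  trank : tsym -> nat;
  tbase : forall t : tsym,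
    schterm farity
      (fun u : {u : tsym | trank u < trank t} => tiarity (sval u))
      (fun u : {u : tsym | trank u < trank t} => tnarity (sval u))
      'I_(tiarity t) 'I_(tnarity t);
  tstep : forall t : tsym,
    schterm farity
      (fun u : {u : tsym | trank u < trank t} => tiarity (sval u))
      (fun u : {u : tsym | trank u < trank t} => tnarity (sval u))
      (option 'I_(tiarity t)) (option 'I_(tnarity t))
}.

Section Schematic.
Variable S : signature.

Definition assignment := param S -> nat.

(* The first-order variables: ordinary ones, and the X(nu_1, ..., nu_k). *)
Definition fvar : eqType :=
  (ovar S + {X : vclass S & (varity X).-tuple nat})%type.
Definition fterm := foterm (@farity S) fvar.

Definition vexp : eqType :=
  {X : vclass S & (varity X).-tuple (nterm (param S))}.
Definition sterm :=
  schterm (@farity S) (@tiarity S) (@tnarity S) (ovar S + vexp)%type (param S).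

Fixpoint unfold_below (n : nat) : forall t : tsym S, trank t < n ->
    ('I_(tiarity t) -> fterm) -> ('I_(tnarity t) -> nat) -> nat -> fterm :=
  match n with
  | 0 => fun t lt_t => False_rect _ (notF lt_t)
  | n'.+1 => fun t lt_t xs ns k =>
      let U (u : {u : tsym S | trank u < trank t}) :=
        unfold_below (leq_trans (svalP u) lt_t) in
      iteri k
        (fun m xi => teval U (oapp xs xi) (oapp ns m) (tstep t))
        (teval U xs ns (tbase t))
  end.

Definition unfold_sym (t : tsym S) := unfold_below (ltnSn (trank t)).
Arguments unfold_sym : clear implicits.

Lemma unfold_belowE n t (lt_t : trank t < n) :
  unfold_below lt_t = unfold_sym t.
Proof.
suff E k l u (lk : trank u < k) (ll : trank u < l) :
  unfold_below lk = unfold_below ll by exact: E.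
elim: k l u lk ll => // k IHk [//|l] u lk ll /=.
apply/funext => xs; apply/funext => ns; apply/funext => m.
congr (iteri m _ _); last by apply: eq_teval => w; apply: IHk.
by apply/funext => i; apply/funext => xi; apply: eq_teval => w; apply: IHk.
Qed.

Lemma unfold_sym0 t xs ns :
  unfold_sym t xs ns 0 = teval (fun u => unfold_sym (sval u)) xs ns (tbase t).
Proof. by apply: eq_teval => u; apply: unfold_belowE. Qed.

Lemma unfold_symS t xs ns m :
  unfold_sym t xs ns m.+1 =
  teval (fun u => unfold_sym (sval u))
    (oapp xs (unfold_sym t xs ns m)) (oapp ns m) (tstep t).
Proof. by apply: eq_teval => u; apply: unfold_belowE. Qed.

Definition veval (sigma : assignment) (A : vexp) : fvar :=
  inr (Tagged (fun X => (varity X).-tuple nat)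
              [tuple of map (neval sigma) (tagged A)]).

Definition seval (sigma : assignment) : sterm -> fterm :=
  teval unfold_sym
    (fun v => match v with
              | inl x => FVar (@farity S) (inl x : fvar)
              | inr A => FVar (@farity S) (veval sigma A)
              end)
    sigma.

Definition standard_index (m : param S) (r : nterm (param S)) : bool :=
  r \in [:: NPar m; NZero; NPred (NPar m); NSucc (NPar m)].

Definition standard_vexp (A : vexp) : bool :=
  [forall i, standard_index (tnth (vparams (tag A)) i) (tnth (tagged A) i)].

Definition standard_term (t : sterm) : Prop :=
  forall A : vexp, inr A \in leaves t -> standard_vexp A.

Definition param_unifiable (A B : vexp) : Prop :=
  exists sigma : assignment, veval sigma A = veval sigma B.

Definition vexp_params (A : vexp) : seq (param S) :=
  flatten [seq nparams r | r <- tagged A].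

Definition sterm_params (t : sterm) : seq (param S) :=
  flatten [seq nparams r | r <- numargs t] ++
  flatten [seq (match v with inl _ => [::] | inr A => vexp_params A end)
          | v <- leaves t].

(* Finite sets of bindings are lists, to be compared with [=i]. *)
Definition bindings := seq (vexp * sterm).
Definition fsubst := seq (fvar * fterm).

Definition bindings_params (D : bindings) : seq (param S) :=
  flatten [seq vexp_params b.1 ++ sterm_params b.2 | b <- D].

Definition standard_ssubst (Theta : bindings) : Prop :=
  (forall i : 'I_(size Theta),
     standard_vexp (tnth (in_tuple Theta) i).1 /\
     standard_term (tnth (in_tuple Theta) i).2) /\
  (forall i j : 'I_(size Theta), i <> j ->
     ~ param_unifiable (tnth (in_tuple Theta) i).1
                       (tnth (in_tuple Theta) j).1).

(* sigma(Delta), which for an s-substitution Theta is Theta[sigma] *)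
Definition beval (sigma : assignment) (D : bindings) : fsubst :=
  [seq (veval sigma b.1, seval sigma b.2) | b <- D].

Definition lookup (K : eqType) (T : Type) (s : seq (K * T)) (k : K) : option T :=
  ohead [seq b.2 | b <- s & b.1 == k].

Definition bcompose (K : eqType) (T : Type) (app : seq (K * T) -> T -> T)
    (s1 s2 : seq (K * T)) : seq (K * T) :=
  [seq (b.1, app s2 b.2) | b <- s1] ++
  [seq b <- s2 | b.1 \notin [seq a.1 | a <- s1]].

Fixpoint fapply (s : fsubst) (t : fterm) : fterm :=
  match t with
  | FVar x => odflt (FVar (@farity S) x) (lookup s x)
  | FFun f ts => FFun [ffun i => fapply s (ts i)]
  end.

Definition fcompose : fsubst -> fsubst -> fsubst := bcompose fapply.

Lemma lookup_map (K : eqType) (T T' : Type) (g : T -> T') (s : seq (K * T)) k :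
  lookup [seq (b.1, g b.2) | b <- s] k = omap g (lookup s k).
Proof. by elim: s => //= b s; rewrite /lookup /=; case: (b.1 == k). Qed.

Lemma fapply_fcompose (s1 s2 : fsubst) (t : fterm) :
  fapply (fcompose s1 s2) t = fapply s2 (fapply s1 t).
Proof.
elim/foterm_ind': t => [x|f ts IH] /=; last first.
  by congr FFun; apply/ffunP => i; rewrite !ffunE IH.
rewrite /fcompose /bcompose /lookup filter_cat map_cat -filter_predI.
have := lookup_map (fapply s2) s1 x; rewrite /lookup.
case E: [seq b.2 | b <- s1 & b.1 == x] => [|u us] /=; last first.
  by case: [seq b.2 | b <- [seq (b.1, fapply s2 b.2) | b <- s1] & b.1 == x]
    => //= ? ? [->].
case: [seq b.2 | b <- [seq (b.1, fapply s2 b.2) | b <- s1] & b.1 == x] => //= _.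
congr odflt; congr ohead; congr map; apply: eq_filter => b /=.
case: eqP => //= ->; apply/mapP => -[a a_s1 xE].
have : a \in [seq b <- s1 | b.1 == x] by rewrite mem_filter xE eqxx.
by move: E; case: [seq b <- s1 | b.1 == x].
Qed.

Definition functional_fsubst (s : fsubst) : Prop :=
  forall x t u, (x, t) \in s -> (x, u) \in s -> t = u.

Lemma eq_fapply (s s' : fsubst) :
  functional_fsubst s -> s =i s' -> fapply s =1 fapply s'.
Proof.
move=> fs ss'; elim/foterm_ind' => [x|f ts IH] /=; last first.
  by congr FFun; apply/ffunP => i; rewrite !ffunE IH.
have H (r : fsubst) : if lookup r x is Some t then (x, t) \in r
                      else forall t, (x, t) \notin r.
  rewrite /lookup; case E: [seq b <- r | b.1 == x] => [|[y t] bs] /=.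
    move=> t; apply/negP => xt.
    have : (x, t) \in [seq b <- r | b.1 == x] by rewrite mem_filter xt eqxx.
    by rewrite E.
  have : (y, t) \in [seq b <- r | b.1 == x] by rewrite E mem_head.
  by rewrite mem_filter /= => /andP[/eqP <-].
move: (H s) (H s'); case: (lookup s x) => [t|]; case: (lookup s' x) => [u|] //=.
- by rewrite -ss' => xt xu; rewrite (fs _ _ _ xt xu).
- by move=> xt /(_ t); rewrite -ss' xt.
- by move=> /(_ u) /negP nu xu; case: nu; rewrite ss'.
Qed.

Lemma beval_functional (Theta : bindings) (sigma : assignment) :
  standard_ssubst Theta -> functional_fsubst (beval sigma Theta).
Proof.
move=> [_ unif] x t u /mapP[a a_in ea] /mapP[b b_in eb].
have [/= xa ta] := (congr1 fst ea, congr1 snd ea).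
have [/= xb ub] := (congr1 fst eb, congr1 snd eb).
move: a_in b_in xa ta xb ub => /(@tnthP _ _ (in_tuple Theta))[i ->].
move=> /(@tnthP _ _ (in_tuple Theta))[j ->] -> -> ij ->.
have [-> //|/eqP neq] := eqVneq i j.
by case: (unif i j neq); exists sigma.
Qed.

Definition sapply (D : bindings) : sterm -> sterm :=
  tbind (fun v => match v with
                  | inl x => TVar (inl x)
                  | inr A => odflt (TVar (inr A)) (lookup D A)
                  end).

Definition scompose : bindings -> bindings -> bindings := bcompose sapply.

(* m = 0;  m <> 0 /\ p(m) = 0;  m <> 0 /\ p(m) <> 0 *)
Inductive state_case := StZero | StOne | StMore.

Definition state (ns : seq (param S)) := {m : param S | m \in ns} -> state_case.

Definition case_holds (sigma : assignment) (m : param S) (c : state_case) : Prop :=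
  match c with
  | StZero => neval sigma (NPar m) = 0
  | StOne => neval sigma (NPar m) <> 0 /\ neval sigma (NPred (NPar m)) = 0
  | StMore => neval sigma (NPar m) <> 0 /\ neval sigma (NPred (NPar m)) <> 0
  end.

Definition state_sat (ns : seq (param S)) (p : state ns) (sigma : assignment) :=
  forall m : {m : param S | m \in ns}, case_holds sigma (sval m) (p m).

Definition state_at (ns : seq (param S)) (p : state ns) (m : param S)
  : option state_case := omap p (insub m).

Definition psi_index (c : option state_case) (m : param S)
    (r : nterm (param S)) : nterm (param S) :=
  match c with
  | Some StZero =>
      if r \in [:: NPar m; NPred (NPar m); NZero] then numeral _ 0
      else if r == NSucc (NPar m) then numeral _ 1
      else r
  | Some StOne =>
      if r == NPred (NPar m) then numeral _ 0
      else if r == NPar m then numeral _ 1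
      else if r == NSucc (NPar m) then numeral _ 2
      else r
  | _ => r
  end.

Definition psi_vexp (ns : seq (param S)) (p : state ns) (A : vexp) : vexp :=
  let ms := vparams (tag A) in
  Tagged (fun X => (varity X).-tuple (nterm (param S)))
    [tuple psi_index (state_at p (tnth ms i)) (tnth ms i) (tnth (tagged A) i)
    | i < varity (tag A)].

Definition psi_term (ns : seq (param S)) (p : state ns) : sterm -> sterm :=
  tbind (fun v => match v with
                  | inl x => TVar (inl x)
                  | inr A => TVar (inr (psi_vexp p A))
                  end).

Definition psi_bindings (ns : seq (param S)) (p : state ns) (D : bindings)
  : bindings := [seq (psi_vexp p b.1, psi_term p b.2) | b <- D].

(* (Theta1 o Theta2)|_p *)
Definition compose_at (ns : seq (param S)) (p : state ns)
    (Theta1 Theta2 : bindings) : bindings :=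
  scompose (psi_bindings p Theta1) (psi_bindings p Theta2).

End Schematic.
Arguments unfold_sym {S} t _ _ _.

(* Main.v *)
Require Import Defs.
From mathcomp Require Import all_boot.
From mathcomp Require Import boolp.

Set Implicit Arguments.
Unset Strict Implicit.
Unset Printing Implicit Defensive.

(* In a fixed state p the map psi_p preserves the value of every variable
   expression, and it is a normal form: two standard variable expressions over
   the parameters of p that some assignment in S(p) evaluates to the same
   variable become syntactically identical under psi_p.  Hence syntactic
   matching after psi_p agrees with matching of first-order variables, and the
   theorem follows because first-order substitution commutes with the unfolding
   of schematic symbols, whose defining equations are closed. *)

Section TermEvaluation.
Variables (F : Type) (far : F -> nat) (T : Type) (iar nar : T -> nat).
Variables (V N W : Type).
Variable U : forall t : T, ('I_(iar t) -> foterm far W) ->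
  ('I_(nar t) -> nat) -> nat -> foterm far W.

Lemma teval_tbind rho sigma (g : V -> schterm far iar nar V N) u :
  teval U rho sigma (tbind g u) =
  teval U (fun v => teval U rho sigma (g v)) sigma u.
Proof.
elim/schterm_ind': u => [v|f ts IH|t ts rs r IH] //=.
  by congr FFun; apply/ffunP => i; rewrite !ffunE IH.
by congr U; apply/funext => i; rewrite ffunE IH.
Qed.

End TermEvaluation.

Lemma mem_flatten_enum (I : finType) (E : eqType) (h : I -> seq E) i x :
  x \in h i -> x \in flatten [seq h j | j <- enum I].
Proof. by move=> xi; apply/flatten_mapP; exists i; rewrite ?mem_enum. Qed.

(** Agreement is asked only on the leaves of [u]: the matching property of psi_p is available only
    for standard variable expressions over the parameters of the state. *)
Lemma eq_in_teval (F : Type) (far : F -> nat) (T : Type) (iar nar : T -> nat)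
    (V : eqType) (N W : Type)
    (U : forall t : T, ('I_(iar t) -> foterm far W) ->
       ('I_(nar t) -> nat) -> nat -> foterm far W)
    (rho rho' : V -> foterm far W) sigma (u : schterm far iar nar V N) :
  {in leaves u, rho =1 rho'} -> teval U rho sigma u = teval U rho' sigma u.
Proof.
elim/schterm_ind': u => [v|f ts IH|t ts rs r IH] /= H.
- by apply: H; rewrite mem_head.
- congr FFun; apply/ffunP => i; rewrite !ffunE; apply: IH => v vi.
  by apply: H; apply: (mem_flatten_enum vi).
- congr U; apply/funext => i; apply: IH => v vi.
  by apply: H; apply: (mem_flatten_enum vi).
Qed.

Section Schematic.
Variable S : signature.
Implicit Types (sigma : assignment S) (A B : vexp S).

(** [U] is left abstract to serve twice: for the symbols of smaller rank inside the induction that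
    follows, and then for the full [unfold_sym]. *)
Lemma fapply_teval (s : fsubst S) (T : Type) (iar nar : T -> nat) (V N : Type)
    (U : forall t : T, ('I_(iar t) -> fterm S) -> ('I_(nar t) -> nat) ->
       nat -> fterm S) (rho : V -> fterm S) (sigma : N -> nat) u :
  (forall t xs ns k, fapply s (U t xs ns k) = U t (fapply s \o xs) ns k) ->
  fapply s (teval U rho sigma u) = teval U (fapply s \o rho) sigma u.
Proof.
move=> HU; elim/schterm_ind': u => [v|f ts IH|t ts rs r IH] //=.
  by congr FFun; apply/ffunP => i; rewrite !ffunE IH.
by rewrite HU; congr U; apply/funext => i /=; rewrite IH.
Qed.

(** The only leaves of [tbase] and [tstep] are formal arguments, so a substitution can act only on
    the values [xs]. The induction is on a bound for the rank, then on the recursion argument. *)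
Lemma fapply_unfold_sym (s : fsubst S) (t : tsym S) xs ns k :
  fapply s (unfold_sym t xs ns k) = unfold_sym t (fapply s \o xs) ns k.
Proof.
have [n] := ubnP (trank t); elim: n t xs ns k => // n IH t xs ns k lt_tn.
have HU (u : {u : tsym S | trank u < trank t}) ys ms l :
    fapply s (unfold_sym (sval u) ys ms l) =
    unfold_sym (sval u) (fapply s \o ys) ms l.
  by apply: IH; apply: leq_trans (svalP u) _.
elim: k => [|k IHk]; first by rewrite !unfold_sym0 fapply_teval.
rewrite !unfold_symS fapply_teval //; congr teval.
(* The leaf [None] is xi, whose value is the unfolding at [k]; there [IHk] applies. *)
by apply/funext => -[i|] /=.
Qed.

(** This names the anonymous leaf valuation inside [seval], so that it can be composed with
    [fapply s]. *)
Definition leaf_eval sigma (v : ovar S + vexp S) : fterm S :=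
  match v with
  | inl x => FVar (@farity S) (inl x : fvar S)
  | inr A => FVar (@farity S) (veval sigma A)
  end.

Lemma fapply_seval (s : fsubst S) sigma (u : sterm S) :
  fapply s (seval sigma u) =
  teval unfold_sym (fapply s \o leaf_eval sigma) sigma u.
Proof. by rewrite /seval fapply_teval //; apply: fapply_unfold_sym. Qed.

Section State.
Variables (ns : seq (param S)) (p : state ns) (sigma : assignment S).
Hypothesis p_sigma : state_sat p sigma.

Lemma state_at_sat m c : state_at p m = Some c -> case_holds sigma m c.
Proof.
by rewrite /state_at; case: insubP => //= u _ <- [<-]; apply: p_sigma.
Qed.

Lemma state_at_in m : m \in ns -> exists c, state_at p m = Some c.
Proof. by move=> m_ns; rewrite /state_at insubT /=; eexists. Qed.

Lemma neval_psi_index m r :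
  neval sigma (psi_index (state_at p m) m r) = neval sigma r.
Proof.
case E: (state_at p m) => [c|//]; have := state_at_sat E.
case: c {E} => //= [m0|[m0 m1]].
  rewrite !inE; case: ifP => [/or3P[]/eqP-> //=|_]; rewrite ?m0 //.
  by case: eqP => // -> /=; rewrite m0.
have {m0}m1 : sigma m = 1 by case: (sigma m) m0 m1 => [//|[]].
by do 3 (case: eqP => [-> /=|_]; rewrite ?m1 //).
Qed.

(** In the first two cases of a state every standard index becomes the numeral of its value; in the
    third, equal values already force equal indices. *)
Lemma psi_index_inj m r r' :
  standard_index m r -> standard_index m r' ->
  {subset nparams r <= ns} -> {subset nparams r' <= ns} ->
  neval sigma r = neval sigma r' ->
  psi_index (state_at p m) m r = psi_index (state_at p m) m r'.
Proof.
move=> st st' sub sub'.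
(* A parameter outside the state does not occur, so the only index left is 0. *)
have [m_ns|m_ns] := boolP (m \in ns); last first.
  have zero q : standard_index m q -> {subset nparams q <= ns} -> q = NZero.
    rewrite /standard_index !inE.
    by case/or4P => /eqP-> // /(_ m (mem_head _ _)); rewrite (negPf m_ns).
  by rewrite (zero r) // (zero r').
have [c E] := state_at_in m_ns; have := state_at_sat E; rewrite E {E} => c_holds.
move: st st'; rewrite /standard_index !inE.
case: c c_holds => /=.
- by move=> m0; case/or4P => /eqP->; case/or4P => /eqP->;
    rewrite /= ?inE ?eqxx ?m0.
- case=> m0 m1; have {m0}m1 : sigma m = 1 by case: (sigma m) m0 m1 => [|[]].
  by case/or4P => /eqP->; case/or4P => /eqP->; rewrite /= ?eqxx ?m1.
(* Here [sigma m] is [k.+2], so 0, p(m), m, s(m) take the four distinct values 0, k+1, k+2, k+3. *)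
- case Em: (sigma m) => [|[|k]] [] // _ _.
  case/or4P => /eqP->; case/or4P => /eqP-> //=; rewrite ?Em //= => /eqP;
    by rewrite ?eqSS ?eqn_leq ?ltnn ?[k.+1 < k]ltnNge ?leqnSn ?andbF.
Qed.

Lemma veval_psi_vexp A : veval sigma (psi_vexp p A) = veval sigma A.
Proof.
case: A => X a; rewrite /veval /psi_vexp /=; congr (inr (Tagged _ _)).
by apply: eq_from_tnth => i; rewrite !tnth_map tnth_ord_tuple neval_psi_index.
Qed.

(** Only parameters that occur in [A] must lie in [ns]; the list of its class may contain others, at
    positions where the index is 0. *)
Definition standard_over (A : vexp S) : Prop :=
  standard_vexp A /\ {subset vexp_params A <= ns}.

Lemma psi_vexp_eq A B : standard_over A -> standard_over B ->
  (psi_vexp p A == psi_vexp p B) = (veval sigma A == veval sigma B).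
Proof.
move=> [stA subA] [stB subB]; apply/eqP/eqP => [AB|].
  by rewrite -veval_psi_vexp AB veval_psi_vexp.
case: A B stA subA stB subB => [X a] [Y b] stA subA stB subB E.
have {E}AB := inr_inj E.
have XY : X = Y := congr1 tag AB; case: Y / XY b stB subB AB => b stB subB.
move=> /eqP; rewrite eq_Tagged => /eqP /= ab.
rewrite /psi_vexp /=; congr Tagged; apply: eq_from_tnth => i.
rewrite !tnth_map tnth_ord_tuple.
have sub c : {subset vexp_params (Tagged _ c : vexp S) <= ns} ->
    {subset nparams (tnth c i) <= ns}.
  by move=> H x xi; apply: H; apply/flatten_mapP; exists (tnth c i);
    rewrite ?mem_tnth.
apply: psi_index_inj; [exact: (forallP stA)|exact: (forallP stB)|exact: sub|
  exact: sub|].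
by have := congr1 (fun t => tnth t i) ab; rewrite !tnth_map.
Qed.

Lemma seval_psi_term (u : sterm S) : seval sigma (psi_term p u) = seval sigma u.
Proof.
rewrite /seval /psi_term teval_tbind; congr teval.
by apply/funext => -[x|A] //=; rewrite veval_psi_vexp.
Qed.

(** Both lookups scan [D] in the same order, and by [psi_vexp_eq] their tests agree at each binding,
    so they stop at the same one. *)
Lemma lookup_psi_bindings (D : bindings S) A :
  standard_over A -> {in D, forall b, standard_over b.1} ->
  lookup (beval sigma D) (veval sigma A) =
  omap (seval sigma) (lookup (psi_bindings p D) (psi_vexp p A)).
Proof.
move=> stA; rewrite /lookup; elim: D => //= b D IH stD.
rewrite psi_vexp_eq //; last by apply: stD; rewrite mem_head.
have [_|_] := eqVneq (veval sigma b.1) (veval sigma A).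
  by rewrite /= seval_psi_term.
by apply: IH => c cD; apply: stD; rewrite inE cD orbT.
Qed.

Lemma seval_sapply_psi (D : bindings S) (u : sterm S) :
  (forall A, inr A \in leaves u -> standard_over A) ->
  {in D, forall b, standard_over b.1} ->
  seval sigma (sapply (psi_bindings p D) (psi_term p u)) =
  fapply (beval sigma D) (seval sigma u).
Proof.
move=> stu stD; rewrite fapply_seval /seval /sapply /psi_term !teval_tbind.
apply: eq_in_teval => -[x|A] /= xu.
  (* An ordinary variable is an [inl], while the domain of [beval sigma D] consists of [inr]
     variables: no binding matches. *)
  by rewrite /lookup; elim: (D).
rewrite lookup_psi_bindings //; last exact: stu.
by case: (lookup _ _) => //=; rewrite veval_psi_vexp.
Qed.

(** The two sides agree even as lists: psi_p and evaluation act binding by binding, and both filters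
    drop the same bindings of [D2]. *)
Lemma beval_compose_at (D1 D2 : bindings S) :
  {in D1, forall b, standard_over b.1} ->
  {in D1, forall b A, inr A \in leaves b.2 -> standard_over A} ->
  {in D2, forall b, standard_over b.1} ->
  beval sigma (compose_at p D1 D2) =
  fcompose (beval sigma D1) (beval sigma D2).
Proof.
move=> st1 stt1 st2; rewrite /compose_at /scompose /fcompose /bcompose.
rewrite {1}/beval map_cat; congr (_ ++ _).
  rewrite /psi_bindings /beval -!map_comp; apply/eq_in_map => b bD /=.
  by rewrite veval_psi_vexp seval_sapply_psi //; apply: stt1.
rewrite /psi_bindings /beval !filter_map -!map_comp.
rewrite (eq_map (g := fun b => (veval sigma b.1, seval sigma b.2))); last first.
  by move=> b /=; rewrite veval_psi_vexp seval_psi_term.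
congr map; apply: eq_in_filter => b bD /=; congr negb.
apply/mapP/mapP => -[a aD /= /eqP E]; exists a => //=;
  apply/eqP; move: E; rewrite psi_vexp_eq //; by [apply: st1|apply: st2].
Qed.

End State.

Lemma standard_ssubst_dom (D : bindings S) (ns : seq (param S)) :
  standard_ssubst D -> {subset bindings_params D <= ns} ->
  {in D, forall b, standard_over ns b.1}.
Proof.
move=> [stD _] sub b bD; split.
  by have /(@tnthP _ _ (in_tuple D))[i ->] := bD; case: (stD i).
move=> x xb; apply: sub; apply/flatten_mapP; exists b => //.
by rewrite mem_cat xb.
Qed.

Lemma standard_ssubst_range (D : bindings S) (ns : seq (param S)) :
  standard_ssubst D -> {subset bindings_params D <= ns} ->
  {in D, forall b A, inr A \in leaves b.2 -> standard_over ns A}.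
Proof.
move=> [stD _] sub b bD A Ab; split.
  move: Ab; have /(@tnthP _ _ (in_tuple D))[i ->] := bD.
  by case: (stD i) => _; apply.
move=> x xA; apply: sub; apply/flatten_mapP; exists b => //.
rewrite !mem_cat; apply/orP; right; apply/orP; right.
by apply/flatten_mapP; exists (inr A).
Qed.

End Schematic.

Theorem theorem2 (S : signature) (Theta1 Theta2 : bindings S)
    (ns : seq (param S)) :
  standard_ssubst Theta1 -> standard_ssubst Theta2 ->
  {subset bindings_params Theta1 <= ns} ->
  {subset bindings_params Theta2 <= ns} ->
  forall (p : state ns) (sigma : assignment S), state_sat p sigma ->
    beval sigma (compose_at p Theta1 Theta2) =i
      fcompose (beval sigma Theta1) (beval sigma Theta2).
Proof.
move=> st1 st2 sub1 sub2 p sigma p_sigma b.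
rewrite (beval_compose_at p_sigma) //.
- exact: standard_ssubst_dom.
- exact: standard_ssubst_range.
- exact: standard_ssubst_dom.
Qed.
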